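(* Let $F$ be a finite field of characteristic 2, and let $k, r$ be integers with $2 \leq r \leq k-1$. If there is a subset $X \subseteq F$ with $|X| = 2k+r$ and $e_{2m+1}(X) = 0_F$ for every nonnegative integer $m$ with $2m+1 \leq r$, then $\chi(K^2(2k+r,k)) \leq |F|^r$.
   Context: For a finite subset $Z = \{z_1,\ldots,z_n\}$ of a field $F$ and integer $i\ge 0$, $e_i(Z) = \sum_{1 \le t_1 < \cdots < t_i \le n} z_{t_1}\cdots z_{t_i}$, with $e_0(Z)=1_F$ and $e_i(Z)=0_F$ if $i>|Z|$. The Kneser graph $K(n,k)$ has as vertices the $k$-element subsets of an $n$-element set, adjacent iff disjoint; $K^2(n,k)$ is its square (same vertices, two distinct vertices adjacent iff at distance at most 2 in $K(n,k)$); $\chi$ is the chromatic number. *)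

(* Defs.v *)
From mathcomp Require Import all_boot all_order all_algebra.

Set Implicit Arguments.
Unset Strict Implicit.
Unset Printing Implicit Defensive.

Import GRing.Theory.

Section ElementarySymmetric.
Local Open Scope ring_scope.

Definition elem_sym (F : finFieldType) (Z : {set F}) (i : nat) : F :=
  \sum_(A : {set F} | (A \subset Z) && (#|A| == i)) \prod_(z in A) z.

Lemma elem_sym0 (F : finFieldType) (Z : {set F}) : elem_sym Z 0 = 1.
Proof.
rewrite /elem_sym (big_pred1 set0) ?big_set0 // => A /=.
by rewrite cards_eq0 andbC; case: eqP => // ->; rewrite sub0set.
Qed.

Lemma elem_sym_gt (F : finFieldType) (Z : {set F}) (i : nat) :
  (#|Z| < i)%N -> elem_sym Z i = 0.
Proof.
move=> ltZi; apply: big_pred0 => A; apply/negP => /andP[/subset_leq_card leAZ].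
by move/eqP=> eqAi; move: ltZi; rewrite -eqAi ltnNge leAZ.
Qed.

End ElementarySymmetric.

(* A graph is given by its adjacency relation on a finite vertex type. *)
Section Graphs.
Variable T : finType.
Implicit Types (e : rel T) (x y : T).

(* Some walk from x to y has length at most d. *)
Definition dist_le e (d : nat) x y : bool :=
  [exists m : 'I_d.+1, exists p : m.-tuple T, path e x p && (last x p == y)].

Definition graph_square e : rel T :=
  [rel x y | (x != y) && dist_le e 2 x y].

Definition colorable e (c : nat) : bool :=
  [exists f : {ffun T -> 'I_c}, forall x, forall y, e x y ==> (f x != f y)].

(* The search is bounded by #|T|, as a loopless graph is #|T|-colorable; on a
   relation with loops the value #|T| is meaningless. *)
Definition chromatic_number e : nat :=
  [arg min_(c < (ord_max : 'I_#|T|.+1) | colorable e c) (c : nat)].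

Lemma chromatic_numberP e : irreflexive e ->
  colorable e (chromatic_number e) /\
  (forall c, colorable e c -> chromatic_number e <= c).
Proof.
move=> irr_e; have col_max : colorable e (ord_max : 'I_#|T|.+1).
  apply/existsP; exists [ffun x => enum_rank x].
  apply/forallP=> x; apply/forallP=> y; apply/implyP=> exy; rewrite !ffunE.
  by apply: contraTneq exy => /enum_rank_inj->; rewrite irr_e.
rewrite /chromatic_number; case: arg_minnP => // c col_c min_c.
split=> // d col_d; have [ltd | led] := ltnP d #|T|.+1.
  exact: (min_c (Ordinal ltd)).
exact: leq_trans (ltnW (ltn_ord c)) led.
Qed.

Lemma graph_square_irr e : irreflexive (graph_square e).
Proof. by move=> x; rewrite /graph_square /= eqxx. Qed.

End Graphs.

Notation kneser_vertex n k := {A : {set 'I_n} | #|A| == k}.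

Definition kneser (n k : nat) : rel (kneser_vertex n k) :=
  [rel A B : kneser_vertex n k | [disjoint val A & val B]].

(* Main.v *)
(** Identify the ground set with [X] and colour a [k]-subset [A] by
    [(e_1(A), ..., e_r(A))], i.e. by [p_A = \prod_(z in A) (1 + z t)] modulo
    [t^(r+1)].  If two distinct sets of the same colour have a common neighbour,
    then [|A :\: B| <= r]; cancelling [p_(A :&: B)] leaves
    [p_(A :\: B) = p_(B :\: A)], which is absurd for disjoint nonempty sets of
    equal size.  If they are disjoint, put [C = X :\: (A :|: B)], of size [r];
    then [p_X = p_A^2 p_C] modulo [t^(r+1)].  In characteristic 2 the hypothesis
    says that [p_X' = 0] modulo [t^r], and [(p_A^2)' = 0], so [p_C' = 0],
    although [p_C] has a simple root because [C] has a nonzero element. *)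
Require Import Defs.
From mathcomp Require Import all_boot all_order all_algebra.

Set Implicit Arguments.
Unset Strict Implicit.
Unset Printing Implicit Defensive.

Import GRing.Theory.

Section ElementarySymmetricPolynomial.
Local Open Scope ring_scope.
Variable F : finFieldType.
Implicit Types (A B C X Z : {set F}) (z : F) (p q : {poly F}) (i n r : nat).

(** With factors [1 + z t] the constant coefficient is 1, so [esym_poly Z] is invertible modulo
    powers of ['X]; the price is that [0] contributes a trivial factor and leaves no trace. *)
Definition esym_poly Z : {poly F} := \prod_(z in Z) (1 + z *: 'X).

Lemma coef_esym_poly Z i : (esym_poly Z)`_i = elem_sym Z i.
Proof.
rewrite /esym_poly (eq_bigr (fun z => z *: 'X + 1)); last first.
  by move=> z _; rewrite addrC.
rewrite big_mkcond /=.
(* The factors outside [Z] become [0 + 1], so that [bigA_distr] expands over all subsets of [F];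
   those not inside [Z] pick up a zero factor. *)
rewrite (eq_bigr (fun z => (if z \in Z then z *: 'X else 0) + 1)); last first.
  by move=> z _; case: ifP => // _; rewrite add0r.
rewrite bigA_distr /= /elem_sym coef_sum big_mkcond [RHS]big_mkcond /=.
apply: eq_bigr => A _.
have [sAZ|nsAZ] /= := boolP (A \subset Z); last first.
  have /subsetPn[z zA zZ] := nsAZ.
  by rewrite (bigD1 z) //= zA (negPf zZ) mul0r coef0.
rewrite -big_mkcond /= (eq_bigr (fun z => z%:P * 'X)); last first.
  by move=> z zA; rewrite (subsetP sAZ) // mul_polyC.
rewrite big_split /= prodr_const -rmorph_prod /= mul_polyC coefZ coefXn.
by rewrite eq_sym; case: eqP; rewrite ?mulr1 ?mulr0.
Qed.

Lemma esym_polyU A B : [disjoint A & B] ->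
  esym_poly (A :|: B) = esym_poly A * esym_poly B.
Proof.
move=> dAB; rewrite /esym_poly -bigU //.
by apply: eq_bigl => z; rewrite !inE.
Qed.

Lemma root_esym_poly Z z : z != 0 -> root (esym_poly Z) (- z^-1) = (z \in Z).
Proof.
move=> nz_z; rewrite /root horner_prod.
apply/prodf_eq0/idP => [[w wZ]|zZ]; last first.
  by exists z => //; rewrite !hornerE mulrN divff // subrr.
rewrite !hornerE mulrN subr_eq0 eq_sym -(inj_eq (mulIf nz_z)) mul1r.
by rewrite mulfVK // => /eqP <-.
Qed.

Lemma size_esym_poly Z : (size (esym_poly Z) <= #|Z|.+1)%N.
Proof.
by apply/leq_sizeP => i ltZi; rewrite coef_esym_poly elem_sym_gt.
Qed.

Lemma coprimep_Xn_esym_poly n Z : coprimep ('X^n) (esym_poly Z).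
Proof.
apply: coprimep_expl; rewrite coprimep_sym -['X]subr0 coprimep_XsubC.
by rewrite /root horner_coef0 coef_esym_poly elem_sym0 oner_neq0.
Qed.

Lemma Xn_dvdp n p : (forall i, (i < n)%N -> p`_i = 0) -> 'X^n %| p.
Proof.
move=> p0; rewrite -[p](poly_take_drop n).
suff ->: take_poly n p = 0 by rewrite add0r dvdp_mull.
by apply/polyP => i; rewrite coef_take_poly coef0; case: ifP => // /p0.
Qed.

Lemma Xn_dvdp_eq0 n p : 'X^n %| p -> (size p <= n)%N -> p = 0.
Proof.
move=> dvd sz; apply/eqP; apply: contraLR sz => nzp.
by rewrite -ltnNge -(size_polyXn F n) dvdp_leq.
Qed.

Lemma deriv_sqr_pchar2 p : 2 \in [pchar F] -> (p ^+ 2)^`() = 0.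
Proof.
move=> c2; rewrite expr2 derivM mulrC -mulr2n.
by apply/polyP => i; rewrite coefMn coef0 -mulr_natr (pcharf0 c2) mulr0.
Qed.

(** The root [- z^-1] is simple, because no other element of [Z] gives the same root; hence the
    derivative does not vanish there. *)
Lemma deriv_esym_poly_neq0 Z z : z != 0 -> z \in Z -> (esym_poly Z)^`() != 0.
Proof.
move=> nz_z zZ; apply/eqP => d0.
have /(congr1 (fun p => p.[- z^-1])) := d0.
rewrite /esym_poly (big_setD1 z) //= derivM hornerD !hornerM derivD derivZ.
rewrite derivX -[1]/(1%:P) derivC !hornerE mulrN divff // subrr mul0r addr0.
move/eqP; rewrite mulf_eq0 (negPf nz_z) /= => z0.
by have := root_esym_poly (Z :\ z) nz_z; rewrite /root z0 !inE eqxx.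
Qed.

Lemma Xn_dvdp_esym_poly_sub r A B :
  (forall i, (0 < i <= r)%N -> elem_sym A i = elem_sym B i) ->
  'X^(r.+1) %| esym_poly A - esym_poly B.
Proof.
move=> eqAB; apply: Xn_dvdp => -[|i] lti; rewrite coefB !coef_esym_poly.
  by rewrite !elem_sym0 subrr.
by rewrite eqAB ?subrr.
Qed.

Lemma elem_sym_neq_near r A B : A != B -> #|A| = #|B| ->
  (#|A :\: B| <= r)%N ->
  ~ (forall i, (0 < i <= r)%N -> elem_sym A i = elem_sym B i).
Proof.
move=> neqAB eqc leD /Xn_dvdp_esym_poly_sub.
have eqcD : #|A :\: B| = #|B :\: A| by rewrite !cardsD eqc setIC.
have splitD U V : esym_poly U = esym_poly (U :&: V) * esym_poly (U :\: V).
  rewrite -esym_polyU ?setID // -setI_eq0; apply/eqP/setP => z.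
  by rewrite !inE; case: (z \in V); rewrite ?andbF.
(* The common factor is coprime to ['X^(r.+1)]; what remains has degree at most [r], so divisibility
   forces it to be 0. *)
rewrite (splitD A B) (splitD B A) [B :&: A]setIC -mulrBr.
rewrite Gauss_dvdpr ?coprimep_Xn_esym_poly // => /Xn_dvdp_eq0 eq0.
have {eq0 splitD} /eqP : esym_poly (A :\: B) - esym_poly (B :\: A) = 0.
  apply: eq0; apply: leq_trans (size_polyD _ _) _; rewrite size_polyN geq_max.
  by rewrite !(leq_trans (size_esym_poly _)) ?ltnS // -?eqcD.
rewrite subr_eq0 => /eqP eqp.
(* Roots detect only nonzero elements, so both differences lie in [{0}]. Both are nonempty, hence
   both contain [0], although they are disjoint. *)
have eqD z : z != 0 -> (z \in A :\: B) = (z \in B :\: A).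
  by move=> nz; rewrite -!root_esym_poly // eqp.
have D0 z : z \in A :\: B -> z = 0.
  apply: contraTeq => nz; move: (eqD z nz); rewrite !inE.
  by case: (z \in A); case: (z \in B).
have D0' z : z \in B :\: A -> z = 0.
  apply: contraTeq => nz; move: (eqD z nz); rewrite !inE.
  by case: (z \in A); case: (z \in B).
have posD : (0 < #|A :\: B|)%N.
  rewrite lt0n; apply: contraNneq neqAB => c0.
  by rewrite eqEcard eqc leqnn andbT -setD_eq0 -cards_eq0 c0.
have posD' : (0 < #|B :\: A|)%N by rewrite -eqcD.
have [[z zAB] [w wBA]] := (card_gt0P posD, card_gt0P posD').
move: (zAB) (wBA); rewrite (D0 z zAB) (D0' w wBA) !inE.
by move=> /andP[/negPf ->]; rewrite andbF.
Qed.

Lemma elem_sym_neq_disjoint r X A B : 2 \in [pchar F] -> (2 <= r)%N ->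
  A \subset X -> B \subset X -> [disjoint A & B] ->
  #|X :\: (A :|: B)| = r ->
  (forall i, odd i -> (i <= r)%N -> elem_sym X i = 0) ->
  ~ (forall i, (0 < i <= r)%N -> elem_sym A i = elem_sym B i).
Proof.
move=> c2 r2 sAX sBX dAB; set C := X :\: _ => cardC oddX eqAB.
have [h Dh] : exists h, esym_poly B = esym_poly A + h * 'X^(r.+1).
  have /Xn_dvdp_esym_poly_sub/dvdpP[h Dh] :
      forall i, (0 < i <= r)%N -> elem_sym B i = elem_sym A i.
    by move=> i /eqAB.
  by exists h; rewrite -Dh addrC subrK.
have defX : esym_poly X = esym_poly A * esym_poly B * esym_poly C.
  have dC : [disjoint A :|: B & C].
    by rewrite -setI_eq0 setIDA setDIl setDv set0I.
  have sABX : A :|: B \subset X by rewrite subUset sAX.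
  by rewrite -!esym_polyU // -{1}(setIidPr sABX) setID.
have dvdX : 'X^r %| (esym_poly X)^`().
  (* Coefficient [i] is [i.+1] times [elem_sym X i.+1]: the second factor vanishes for [i.+1] odd,
     the first for [i.+1] even. *)
  apply: Xn_dvdp => i lt_ir; rewrite coef_deriv coef_esym_poly.
  have [oddi|eveni] := boolP (odd i.+1); first by rewrite oddX ?mul0rn.
  rewrite -mulr_natr; suff -> : i.+1%:R = 0 :> F by rewrite mulr0.
  by apply/eqP; rewrite -(dvdn_pcharf c2) dvdn2.
have dvdC : 'X^r %| (esym_poly C)^`().
  move: dvdX; rewrite defX Dh mulrDr mulrDl -expr2 derivD derivM.
  rewrite deriv_sqr_pchar2 // mul0r add0r.
  rewrite mulrA [_ * 'X^_ * _]mulrAC.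
  (* Differentiating the error term, a multiple of ['X^(r.+1)], costs one power of ['X], which is
     why the divisor is only ['X^r]. *)
  rewrite derivM derivXn dvdp_addl.
    by rewrite Gauss_dvdpr // coprimep_expr ?coprimep_Xn_esym_poly.
  by rewrite dvdp_add // dvdp_mull ?dvdp_exp2l // -mulr_natr dvdp_mulr.
(* Here [2 <= r] enters: [C] has an element besides [0]. *)
have [z zC nz_z] : exists2 z, z \in C & z != 0.
  have : (0 < #|C :\ 0%R|)%N.
    rewrite -ltnS; apply: leq_trans r2 _; rewrite -cardC (cardsD1 0 C).
    by rewrite -add1n leq_add2r leq_b1.
  by case/card_gt0P => z; rewrite !inE => /andP[nz zC]; exists z; rewrite // !inE.
have /eqP[] := deriv_esym_poly_neq0 nz_z zC; apply: Xn_dvdp_eq0 dvdC _.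
have := size_esym_poly C; rewrite cardC => szC.
apply/leq_sizeP => i ler; rewrite coef_deriv nth_default ?mul0rn //.
exact: leq_trans szC _.
Qed.

End ElementarySymmetricPolynomial.

Lemma graph_square_cases (T : finType) (e : rel T) x y : graph_square e x y ->
  x != y /\ (e x y \/ exists2 z, e x z & e z y).
Proof.
case/andP => neq /existsP[[m ltm] /existsP[[p /= /eqP szp] /andP[]]].
case: p szp => [|z [|w [|? ?]]] /= szp; last by move: ltm; rewrite -szp.
- by rewrite (negPf neq).
- by rewrite andbT => exz /eqP eqy; split; [| left; rewrite -eqy].
- by rewrite andbT => /andP[exz ezw] /eqP eqy; split; [| right; exists z; rewrite -?eqy].
Qed.

Lemma colorable_finType (T C : finType) (e : rel T) (f : T -> C) :
  (forall x y, e x y -> f x <> f y) -> colorable e #|C|.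
Proof.
move=> fP; apply/existsP; exists [ffun x => enum_rank (f x)].
apply/forallP => x; apply/forallP => y; apply/implyP => exy; rewrite !ffunE.
by apply/eqP => /enum_rank_inj; apply: fP.
Qed.

Theorem theorem3p2 (F : finFieldType) (charF2 : 2 \in [pchar F]%R)
    (k r : nat) (r_ge2 : 2 <= r) (r_le : r <= k - 1)
    (X : {set F}) (cardX : #|X| = 2 * k + r)
    (odd_elem_sym : forall m : nat, 2 * m + 1 <= r -> elem_sym X (2 * m + 1) = 0%R) :
  chromatic_number (graph_square (@kneser (2 * k + r) k)) <= #|F| ^ r.
Proof.
have [_ min_chi] := chromatic_numberP (graph_square_irr (@kneser (2 * k + r) k)).
pose h (i : 'I_(2 * k + r)) : F := enum_val (cast_ord (esym cardX) i).
have h_inj : injective h by move=> i j /enum_val_inj /cast_ord_inj.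
have hX (A : {set 'I_(2 * k + r)}) : h @: A \subset X.
  by apply/subsetP => _ /imsetP[i _ ->]; apply: enum_valP.
have hdisj (A B : {set 'I_(2 * k + r)}) :
    [disjoint A & B] -> [disjoint h @: A & h @: B].
  by rewrite -!setI_eq0 -imsetI => [/eqP ->|? ? _ _ /h_inj //]; rewrite imset0.
have hcard (A : kneser_vertex (2 * k + r) k) : #|h @: val A| = k.
  by rewrite card_imset // (eqP (valP A)).
apply: min_chi; rewrite -[r in _ ^ r]card_ord -card_ffun.
(* The shift to [i.+1] skips [elem_sym _ 0], which is always 1. *)
pose f (A : kneser_vertex (2 * k + r) k) := [ffun i : 'I_r => elem_sym (h @: val A) i.+1].
apply: (@colorable_finType _ _ _ f) => A B /graph_square_cases[neqAB adjAB] eqf.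
have {eqf} eqAB i : 0 < i <= r -> elem_sym (h @: val A) i = elem_sym (h @: val B) i.
  by case: i => // i ltir; have /ffunP/(_ (Ordinal ltir)) := eqf; rewrite !ffunE.
case: adjAB => [dAB|[D dAD dDB]].
  apply: (@elem_sym_neq_disjoint F r X (h @: val A) (h @: val B)) eqAB => //.
  - exact: hdisj.
  - rewrite cardsD (setIidPr _) ?subUset ?hX // cardsU.
    have /eqP -> : h @: val A :&: h @: val B == set0 by rewrite setI_eq0 hdisj.
    by rewrite cards0 subn0 !hcard cardX mul2n -addnn addKn.
  - move=> i oddi; rewrite -[i]odd_double_half oddi addnC -mul2n.
    exact: odd_elem_sym.
apply: (@elem_sym_neq_near F r (h @: val A) (h @: val B)) eqAB.
- by apply: contraNneq neqAB => /(imset_inj h_inj)/val_inj ->.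
- by rewrite !hcard.
(* With [D] a common neighbour, [A :\: B] avoids both [B] and [D]; these are disjoint [k]-sets, so
   their union leaves [r] elements of [X]. *)
have sub : h @: val A :\: h @: val B \subset X :\: (h @: val B :|: h @: val D).
  apply/subsetP => z; rewrite !inE => /andP[zB zA].
  rewrite (negPf zB) (subsetP (hX (val A))) // andbT /=.
  by rewrite (disjointFr (hdisj _ _ dAD)).
apply: leq_trans (subset_leq_card sub) _.
rewrite cardsD (setIidPr _) ?subUset ?hX // cardsU.
have /eqP -> : h @: val B :&: h @: val D == set0.
  by rewrite setI_eq0 disjoint_sym hdisj.
by rewrite cards0 subn0 !hcard cardX mul2n -addnn addKn.
Qed.
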